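(* A finite simple graph $G$ is a proper $2$-color-line graph if and only if $G$ is co-bipartite and contains none of $K_5-e$, $F_1$, $F_2$, $F_3$, $F_4$ as an induced subgraph.
   Context: A graph is co-bipartite if its vertex set can be partitioned into two (possibly empty) cliques, i.e., its complement is bipartite. $K_5-e$ is the complete graph on $5$ vertices minus one edge. Each $F_j$ has vertex set $\{a_1,a_2,a_3,b_1,b_2,b_3,u\}$ where $\{a_1,a_2,a_3\}$ and $\{b_1,b_2,b_3\}$ are triangles and $u$ is adjacent to all six other vertices; in $F_1$ there are no edges between $\{a_1,a_2,a_3\}$ and $\{b_1,b_2,b_3\}$; $F_2$ additionally has the edge $a_1b_1$; $F_3$ additionally has the edges $a_1b_1,a_2b_2$; $F_4$ additionally has the edges $a_1b_1,a_2b_2,a_3b_3$ (and no other edges between the triangles). An edge $2$-coloring $\phi:E(H)\to\{1,2\}$ is proper if any two distinct edges sharing an endvertex get different colors. For an edge-colored graph $(H,\phi)$, $\mathrm{CL}(H)$ has vertex set $E(H)$, two distinct vertices being adjacent iff the corresponding edges share an endvertex or have the same color. $G$ is a proper $2$-color-line graph if $G\cong\mathrm{CL}(H)$ for some graph $H$ with a proper edge $2$-coloring. *)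

(* Defs.v *)
From mathcomp Require Import all_boot.

Set Implicit Arguments.
Unset Strict Implicit.
Unset Printing Implicit Defensive.

Record sgraph := SGraph {
  svertex :> finType;
  sedge : rel svertex;
  sedge_sym : symmetric sedge;
  sedge_irrefl : irreflexive sedge
}.

Definition sgraph_iso (G H : sgraph) : Prop :=
  exists f : G -> H, bijective f /\ forall x y, sedge (f x) (f y) = sedge x y.

Section Induced.
Variables (G : sgraph) (S : {set G}).

Definition induced_rel : rel {x : G | x \in S} :=
  fun x y => sedge (val x) (val y).

Lemma induced_sym : symmetric induced_rel.
Proof. by move=> x y; apply: sedge_sym. Qed.

Lemma induced_irrefl : irreflexive induced_rel.
Proof. by move=> x; apply: sedge_irrefl. Qed.

Definition induced : sgraph := SGraph induced_sym induced_irrefl.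
End Induced.

Definition contains_induced (G F : sgraph) : Prop :=
  exists S : {set G}, sgraph_iso F (induced S).

Definition is_clique (G : sgraph) (A : {set G}) : Prop :=
  forall x y, x \in A -> y \in A -> x != y -> sedge x y.

Definition co_bipartite (G : sgraph) : Prop :=
  exists A B : {set G},
    [/\ A :|: B = [set: G], A :&: B = set0, is_clique A & is_clique B].

Definition edge_set (H : sgraph) : {set {set H}} :=
  [set [set x; y] | x in [set: H], y in [set: H] & sedge x y].

Definition edge_type (H : sgraph) : finType := {e : {set H} | e \in edge_set H}.

Definition share_end (H : sgraph) (e f : edge_type H) : bool :=
  [exists x : H, (x \in val e) && (x \in val f)].

Definition proper_coloring (H : sgraph) (phi : edge_type H -> 'I_2) : Prop :=
  forall e f : edge_type H, e != f -> share_end e f -> phi e != phi f.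

Section ColorLine.
Variables (H : sgraph) (phi : edge_type H -> 'I_2).

Definition CL_rel : rel (edge_type H) :=
  fun e f => (e != f) && (share_end e f || (phi e == phi f)).

Lemma CL_sym : symmetric CL_rel.
Proof.
move=> e f; rewrite /CL_rel eq_sym [phi e == _]eq_sym.
by congr (_ && (_ || _)); apply: eq_existsb => x; rewrite andbC.
Qed.

Lemma CL_irrefl : irreflexive CL_rel.
Proof. by move=> e; rewrite /CL_rel eqxx. Qed.

Definition CL : sgraph := SGraph CL_sym CL_irrefl.
End ColorLine.

Definition proper_2_color_line (G : sgraph) : Prop :=
  exists (H : sgraph) (phi : edge_type H -> 'I_2),
    proper_coloring phi /\ sgraph_iso G (CL phi).

(* The missing edge joins the vertices 0 and 1. *)
Definition K5e_rel : rel 'I_5 :=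
  fun x y => (x != y) && ~~ ((x < 2) && (y < 2)).

Lemma K5e_sym : symmetric K5e_rel.
Proof. by move=> x y; rewrite /K5e_rel eq_sym [(x < 2) && _]andbC. Qed.

Lemma K5e_irrefl : irreflexive K5e_rel.
Proof. by move=> x; rewrite /K5e_rel eqxx. Qed.

Definition K5_minus_e : sgraph := SGraph K5e_sym K5e_irrefl.

(* None is u, Some (false, i) is a_{i+1} and Some (true, i) is b_{i+1};
   the edges between the two triangles are a_1 b_1, ..., a_k b_k. *)
Definition two_triangles_rel (k : nat) : rel (option (bool * 'I_3)) :=
  fun x y => match x, y with
  | None, None => false
  | None, Some _ | Some _, None => true
  | Some (s, i), Some (t, j) => if s == t then i != j else (i == j) && (i < k)
  end.

Lemma two_triangles_sym k : symmetric (two_triangles_rel k).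
Proof.
move=> [[s i]|] [[t j]|] //=; rewrite eq_sym [i == j]eq_sym.
by case: (t == s) => //; case: eqP => // ->.
Qed.

Lemma two_triangles_irrefl k : irreflexive (two_triangles_rel k).
Proof. by move=> [[s i]|] //=; rewrite !eqxx. Qed.

Definition two_triangles (k : nat) : sgraph :=
  SGraph (@two_triangles_sym k) (@two_triangles_irrefl k).

Definition F1 : sgraph := two_triangles 0.
Definition F2 : sgraph := two_triangles 1.
Definition F3 : sgraph := two_triangles 2.
Definition F4 : sgraph := two_triangles 3.

(* Main.v *)
Require Import Defs.
From mathcomp Require Import all_boot.

Set Implicit Arguments.
Unset Strict Implicit.
Unset Printing Implicit Defensive.

(** A graph is a proper 2-color-line graph iff its vertices split into two
    cliques such that every vertex has at most two neighbours in the other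
    clique: the edges of one colour form a matching, so at most one edge of the
    other colour passes through each end of a given edge, and conversely the
    two ends of the edge representing [g] can be named after the (at most two)
    neighbours of [g] across.

    In a [K_5 - e]-free graph split into two cliques, a vertex with three
    neighbours across is adjacent to all other vertices.  If one of the cliques
    has at most two non-universal vertices, moving all universal vertices to
    the other clique yields the required splitting.  Otherwise, if there is a
    universal vertex at all, the edges across between non-universal vertices
    form a matching, and three non-universal vertices from each side together
    with a universal one induce some [F_j]. *)

(** * Splittings into two cliques as Boolean colourings *)

Section CliqueColoring.
Variable G : sgraph.

(** This is a proper 2-colouring of the complement; the cliques are the fibres of [c], so they are
    disjoint and cover [G] automatically. *)
Definition clique_coloring (c : G -> bool) : Prop :=
  forall x y, x != y -> c x = c y -> sedge x y.

Definition cross_nbrs (c : G -> bool) (x : G) : {set G} :=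
  [set y | sedge x y && (c x != c y)].

Definition sparse_coloring (c : G -> bool) : Prop :=
  clique_coloring c /\ forall x, #|cross_nbrs c x| <= 2.

Lemma in_cross_nbrs c x y :
  (y \in cross_nbrs c x) = sedge x y && (c x != c y).
Proof. by rewrite inE. Qed.

Lemma cross_nbrs_sym c x y : (y \in cross_nbrs c x) = (x \in cross_nbrs c y).
Proof. by rewrite !in_cross_nbrs sedge_sym eq_sym. Qed.

Lemma cross_nbrs_neq c x y : y \in cross_nbrs c x -> x != y.
Proof. by rewrite in_cross_nbrs => /andP[_]; apply: contraNneq => ->. Qed.

Lemma sedge_neq (x y : G) : sedge x y -> x != y.
Proof. by apply: contraTneq => ->; rewrite sedge_irrefl. Qed.

Lemma clique_coloring_sedgeE c x y : clique_coloring c ->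
  sedge x y = (x != y) && ((y \in cross_nbrs c x) || (c x == c y)).
Proof.
move=> cc; rewrite in_cross_nbrs; have [<-|xy] := eqVneq x y.
  by rewrite sedge_irrefl.
by have [/(cc _ _ xy)->|_] := eqVneq (c x) (c y); rewrite ?orbT ?andbT ?orbF.
Qed.

(** Boolean form of the degree bound: on a concrete graph the distinctness and adjacency hypotheses
    hold by computation, leaving only a test on colours. *)
Lemma sparse_coloring_no_three c x y z t : sparse_coloring c ->
  uniq [:: y; z; t] -> [&& sedge x y, sedge x z & sedge x t] ->
  [&& c x != c y, c x != c z & c x != c t] -> False.
Proof.
move=> [_ /(_ x) dx] Hu /and3P[xy xz xt] /and3P[cy cz ct].
suff: 2 < #|cross_nbrs c x| by rewrite ltnNge dx.
rewrite -[3]/(size [:: y; z; t]) -(card_uniqP Hu).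
apply/subset_leq_card/subsetP=> w; rewrite !inE.
by case/or3P=> /eqP->; apply/andP.
Qed.

Lemma co_bipartiteP : co_bipartite G <-> exists c, clique_coloring c.
Proof.
split=> [[A [B [AB _ cA cB]]]|[c cc]].
  exists (mem A) => x y xy /= exy; have [xA|xA] := boolP (x \in A).
    by apply: cA => //; rewrite -exy.
  have inB z : z \notin A -> z \in B.
    by move=> zA; have := in_setT z; rewrite -AB inE (negPf zA).
  by apply: cB => //; apply: inB; rewrite // -exy.
exists [set x | c x], [set x | ~~ c x]; split.
- by apply/setP=> x; rewrite !inE orbN.
- by apply/setP=> x; rewrite !inE andbN.
- by move=> x y; rewrite !inE => cx cy /cc; apply; rewrite cx cy.
- by move=> x y; rewrite !inE => /negPf cx /negPf cy /cc; apply; rewrite cx cy.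
Qed.

End CliqueColoring.

(** * Heredity of sparse colourings, and graphs that have none *)

Lemma contains_inducedP (G F : sgraph) :
  contains_induced G F <->
  exists f : F -> G,
    injective f /\ forall x y, sedge (f x) (f y) = sedge x y.
Proof.
split=> [[S [f [/bij_inj f_inj fE]]]|[f [f_inj fE]]].
  by exists (val \o f); split; [apply: inj_comp f_inj; apply: val_inj|].
pose S := [set f x | x in [set: F]].
have fS x : f x \in S by apply: imset_f.
exists S, (fun x => Sub (f x) (fS x)); split=> [|x y]; last by rewrite -fE.
apply: inj_card_bij => [x y /(congr1 val)/f_inj //|].
by rewrite card_sig card_imset // cardsT.
Qed.

Lemma sparse_coloring_embedding (G F : sgraph) (f : F -> G) c :
  injective f -> (forall x y, sedge (f x) (f y) = sedge x y) ->
  sparse_coloring c -> sparse_coloring (c \o f).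
Proof.
move=> f_inj fE [cc cd]; split=> [x y xy|x].
  by rewrite -fE; apply: cc; rewrite (inj_eq f_inj).
apply: leq_trans (cd (f x)); rewrite -(card_imset _ f_inj).
by apply/subset_leq_card/subsetP=> _ /imsetP[y + ->]; rewrite !inE fE.
Qed.

Lemma sparse_coloring_induced (G F : sgraph) c :
  @sparse_coloring G c -> contains_induced G F -> exists c', @sparse_coloring F c'.
Proof.
move=> cG /contains_inducedP[f [f_inj fE]].
by exists (c \o f); apply: sparse_coloring_embedding.
Qed.

(** The vertices 0 and 1 get different colours, so the classes have sizes 1 and 4 or 2 and 3. In the
    first case the single vertex is 0 or 1 and is adjacent to 2, 3 and 4; in the second, the smaller
    class contains one of 2, 3, 4, which is adjacent to the whole other class. *)
Lemma K5_minus_e_not_sparse c : ~ @sparse_coloring K5_minus_e c.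
Proof.
move=> sc; have [cc _] := sc.
pose v i (i5 : i < 5) : K5_minus_e := Ordinal i5.
pose v0 := @v 0 isT; pose v1 := @v 1 isT; pose v2 := @v 2 isT.
pose v3 := @v 3 isT; pose v4 := @v 4 isT.
have c01 : c v0 != c v1 by apply/eqP => /(cc v0 v1 isT).
have N x y z t := @sparse_coloring_no_three _ c x y z t sc.
move: c01 (N v0 v2 v3 v4 isT isT) (N v1 v2 v3 v4 isT isT)
  (N v2 v0 v3 v4 isT isT) (N v2 v1 v3 v4 isT isT)
  (N v3 v0 v2 v4 isT isT) (N v3 v1 v2 v4 isT isT)
  (N v4 v0 v2 v3 isT isT) (N v4 v1 v2 v3 isT isT).
by case: (c v0) (c v1) (c v2) (c v3) (c v4) => [] [] [] [] [] //=;
   do ?move/(_ isT).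
Qed.

(** For every [k], the non-edges between [a_i] and [b_j] with distinct indices form a 6-cycle in the
    complement. The triangles therefore get opposite colours, and the apex [None] has three
    neighbours across. *)
Lemma two_triangles_not_sparse k c : ~ @sparse_coloring (two_triangles k) c.
Proof.
move=> sc; have [cc _] := sc.
pose v s i (i3 : i < 3) : two_triangles k := Some (s, Ordinal i3).
pose a0 := @v false 0 isT; pose a1 := @v false 1 isT; pose a2 := @v false 2 isT.
pose b0 := @v true 0 isT; pose b1 := @v true 1 isT; pose b2 := @v true 2 isT.
have D x y : x != y -> ~~ sedge x y -> c x != c y.
  by move=> xy; apply: contraNneq => /(cc _ _ xy).
have Na := @sparse_coloring_no_three _ c None a0 a1 a2 sc isT isT.
have Nb := @sparse_coloring_no_three _ c None b0 b1 b2 sc isT isT.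
move: (D a0 b1 isT isT) (D a0 b2 isT isT) (D a1 b0 isT isT) (D a1 b2 isT isT)
  (D a2 b0 isT isT) (D a2 b1 isT isT) Na Nb.
by case: (c None) (c a0) (c a1) (c a2) (c b0) (c b1) (c b2)
  => [] [] [] [] [] [] [] //= *; auto.
Qed.

(** * From a properly coloured root graph to a sparse colouring *)

Lemma proper_2_color_line_sparse (G : sgraph) :
  proper_2_color_line G -> exists c, @sparse_coloring G c.
Proof.
case=> H [phi [phiP [f [/bij_inj f_inj fE]]]].
have fEE x y : sedge x y = (x != y) && (share_end (f x) (f y) || (phi (f x) == phi (f y))).
  by rewrite -fE /= /CL_rel (inj_eq f_inj).
have two (i j l : 'I_2) : i != j -> i != l -> j = l.
  by case: i j l => [[|[]]] // ? [[|[]]] // ? [[|[]]] // ? _ _; apply: val_inj.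
exists (fun x => phi (f x) == ord0).
have phi_eq x y : ((phi (f x) == ord0) == (phi (f y) == ord0)) = (phi (f x) == phi (f y)).
  by case: (phi (f x)) (phi (f y)) => [[|[]]] // ? [[|[]]].
split=> [x y xy E|x].
  by rewrite fEE xy -phi_eq E eqxx orbT.
have /imset2P[p q _ _ fx] := valP (f x).
(* Two edges crossing [f x] at the same end have the same colour, so they
   coincide: a neighbour across is determined by whether it contains [p]. *)
have inj : {in cross_nbrs (fun x => phi (f x) == ord0) x &,
    injective (fun y => p \in val (f y))}.
  move=> y z; rewrite !in_cross_nbrs !phi_eq !fEE.
  move=> /andP[/andP[xy +] Dxy] /andP[/andP[xz +] Dxz] pyz.
  rewrite (negPf Dxy) (negPf Dxz) !orbF => /existsP[s /andP[sx sy]] /existsP[t /andP[tx tz]].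
  apply/eqP; apply: contraT => yz; suff: phi (f y) != phi (f z).
    by rewrite (two _ _ _ Dxy Dxz) eqxx.
  apply: phiP; first by rewrite (inj_eq f_inj).
  have [py|pNy] := boolP (p \in val (f y)).
    by apply/existsP; exists p; rewrite -pyz py.
  have isq w u : w \in val (f x) -> w \in val (f u) -> p \notin val (f u) -> w = q.
    by rewrite fx !inE => /orP[]/eqP-> // pu /negP[].
  have Es := isq _ _ sx sy pNy; rewrite pyz in pNy; have Et := isq _ _ tx tz pNy.
  by apply/existsP; exists q; rewrite -{1}Es -Et sy tz.
rewrite -(card_in_imset inj); apply: leq_trans (max_card _) _.
by rewrite card_bool.
Qed.

(** * Construction of a root graph from a sparse colouring *)

Section LineRoot.
Variables (G : sgraph) (c : G -> bool).
Hypothesis sc : sparse_coloring c.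

Let nbrs x := enum (cross_nbrs c x).

(* The vertex [inl [set x; y]] is the common end of the edges representing the
   cross neighbours [x] and [y]; [inr (x, b)] is a free end of [x]. *)
Definition root_vertex : finType := ({set G} + G * bool)%type.

(** The Boolean [b] is read as the index 0 or 1 into the list of cross neighbours; the test keeps
    the default of [nth] from being reached. *)
Definition root_end (x : G) (b : bool) : root_vertex :=
  if b < size (nbrs x) then inl [set x; nth x (nbrs x) b] else inr (x, b).

Definition root_edge (x : G) : {set root_vertex} :=
  [set root_end x false; root_end x true].

Lemma root_end_neq x : root_end x false != root_end x true.
Proof.
rewrite /root_end; case: ifP => lt0; case: ifP => lt1; apply/eqP=> // -[] // /setP E.
have nb b : (b : nat) < size (nbrs x) -> nth x (nbrs x) b \in cross_nbrs c x.
  by rewrite -mem_enum; apply: mem_nth.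
have := E (nth x (nbrs x) 0); rewrite !inE eqxx orbT => /esym/orP[/eqP E0|].
  by have := cross_nbrs_neq (nb 0 lt0); rewrite E0 eqxx.
by rewrite nth_uniq ?enum_uniq.
Qed.

(** A free end records its owner, so a shared end is labelled by a pair. That pair contains both [x]
    and [y], hence equals [[set x; y]]. *)
Lemma root_edge_common x y v : x != y ->
  v \in root_edge x -> v \in root_edge y ->
  y \in cross_nbrs c x /\ v = inl [set x; y].
Proof.
move=> xy; have endP z : v \in root_edge z ->
    (exists2 w, w \in cross_nbrs c z & v = inl [set z; w]) \/ exists b, v = inr (z, b).
  have K b : (exists2 w, w \in cross_nbrs c z & root_end z b = inl [set z; w]) \/
      exists b', root_end z b = inr (z, b').
    rewrite /root_end; case: ifP => [lt|_]; last by right; exists b.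
    by left; exists (nth z (nbrs z) b) => //; rewrite -mem_enum mem_nth.
  by rewrite !inE => /orP[]/eqP->.
move=> /endP vx /endP vy.
case: vx vy => [[w wx ->]|[b ->]] [[w' wy]|[b']] //; last first.
  by case=> E; rewrite E eqxx in xy.
case=> /setP/(_ y); rewrite !inE eqxx (eq_sym y x) (negPf xy) /=.
by move/eqP=> ->; rewrite -in_cross_nbrs.
Qed.

(** The degree bound enters here: [y] has index 0 or 1 among the cross neighbours of [x], so one of
    the two ends is named after it. *)
Lemma cross_nbrs_root_edge x y :
  y \in cross_nbrs c x -> inl [set x; y] \in root_edge x.
Proof.
rewrite -mem_enum -/(nbrs x) => yx; have iy := nth_index x yx.
have lt : index y (nbrs x) < size (nbrs x) by rewrite index_mem.
have: index y (nbrs x) < 2.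
  by apply: leq_trans lt _; rewrite -cardE; apply: (sc.2).
rewrite !inE /root_end; case: (index y _) iy lt => [|[|//]] -> lt _.
  by rewrite lt eqxx.
by rewrite lt eqxx orbT.
Qed.

Lemma root_edge_share x y : x != y ->
  [exists v, (v \in root_edge x) && (v \in root_edge y)] = (y \in cross_nbrs c x).
Proof.
move=> xy; apply/existsP/idP => [[v /andP[vx vy]]|yx].
  by have [] := root_edge_common xy vx vy.
exists (inl [set x; y]); rewrite cross_nbrs_root_edge //= setUC.
by rewrite cross_nbrs_root_edge // cross_nbrs_sym.
Qed.

(** If distinct [x] and [y] had the same edge, both of its ends would carry the label [inl
    [set x; y]], but the two ends differ. *)
Lemma root_edge_inj : injective root_edge.
Proof.
move=> x y E; apply/eqP; apply: contraT => xy.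
have same b : root_end x b = inl [set x; y].
  have xb : root_end x b \in root_edge x.
    by rewrite !inE; case: b; rewrite eqxx ?orbT.
  by have [] := root_edge_common xy xb; rewrite -?E.
by have := root_end_neq x; rewrite !same eqxx.
Qed.

Definition root_rel : rel root_vertex :=
  fun v w => (v != w) && [exists x, [set v; w] == root_edge x].

Lemma root_sym : symmetric root_rel.
Proof. by move=> v w; rewrite /root_rel eq_sym setUC. Qed.

Lemma root_irrefl : irreflexive root_rel.
Proof. by move=> v; rewrite /root_rel eqxx. Qed.

Definition root_graph : sgraph := SGraph root_sym root_irrefl.

Lemma root_edgeP (e : {set root_graph}) :
  reflect (exists x, root_edge x = e) (e \in edge_set root_graph).
Proof.
apply: (iffP imset2P) => [[v w _ + ->]|[x <-]].
  by rewrite inE => /and3P[_ _ /existsP[x /eqP->]]; exists x.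
exists (root_end x false) (root_end x true); rewrite ?inE //=.
by rewrite /root_rel root_end_neq; apply/existsP; exists x.
Qed.

Lemma sparse_proper_2_color_line : proper_2_color_line G.
Proof.
have eP x : root_edge x \in edge_set root_graph by apply/root_edgeP; exists x.
pose E x : edge_type root_graph := Sub (root_edge x) (eP x).
have E_inj : injective E by move=> x y /(congr1 val)/root_edge_inj.
have E_bij : bijective E.
  have ex e : exists x, E x == e.
    by have /root_edgeP[x xe] := valP e; exists x; apply/eqP/val_inj.
  exists (fun e => xchoose (ex e)) => [x|e]; last exact/eqP/(xchooseP (ex e)).
  by apply/E_inj/eqP/(xchooseP (ex (E x))).
have [E' E'K EK] := E_bij.
have EE x y : x != y -> share_end (E x) (E y) = (y \in cross_nbrs c x).
  by move=> xy; rewrite -root_edge_share.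
pose phi e : 'I_2 := if c (E' e) then ord0 else ord_max.
have phiE x y : (phi (E x) == phi (E y)) = (c x == c y).
  by rewrite /phi !E'K; case: (c x); case: (c y).
(* Properness: edges sharing an end represent cross neighbours, which have different colours under
   [c]. *)
exists root_graph, phi; split=> [e f|].
  rewrite -(EK e) -(EK f) (inj_eq E_inj) => xy; rewrite EE // phiE in_cross_nbrs.
  by case/andP.
exists E; split=> // x y; rewrite (clique_coloring_sedgeE _ _ sc.1) /= /CL_rel.
rewrite (inj_eq E_inj) phiE; have [//|xy] := eqVneq x y.
by rewrite EE.
Qed.

End LineRoot.

Lemma proper_2_color_lineP (G : sgraph) :
  proper_2_color_line G <-> exists c, @sparse_coloring G c.
Proof.
split=> [/proper_2_color_line_sparse //|[c]].
exact: sparse_proper_2_color_line.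
Qed.

(** * Enumeration along a matching *)

(** Choose related pairs greedily, deleting both members each time; [k] counts the pairs chosen.
    Once no related pair remains, the rest is filled arbitrarily. The resulting pattern is that of
    the edges between the triangles of [two_triangles k]. *)
Lemma matching_enumeration (T : finType) (R : rel T) n (A B : {set T}) :
  {in A & B &, forall a b b', R a b -> R a b' -> b = b'} ->
  {in A & A & B, forall a a' b, R a b -> R a' b -> a = a'} ->
  n <= #|A| -> n <= #|B| ->
  exists (k : nat) (a b : seq T),
    [/\ k <= n, size a = n, size b = n,
      [/\ uniq a, uniq b, {subset a <= A} & {subset b <= B}] &
      forall x0 i j, i < n -> j < n ->
        R (nth x0 a i) (nth x0 b j) = (i == j) && (i < k)].
Proof.
elim: n A B => [|n IH] A B RA RB nA nB; first by exists 0, [::], [::].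
have [[x y] /and3P[/= xA yB xy]|noR] :=
  pickP [pred p : T * T | [&& p.1 \in A, p.2 \in B & R p.1 p.2]].
  have [||||k [a [b [kn sa sb [ua ub aA bB] abE]]]] := IH (A :\ x) (B :\ y).
  - by move=> ? ? ? /setD1P[_ ?] /setD1P[_ ?] /setD1P[_ ?]; apply: RA.
  - by move=> ? ? ? /setD1P[_ ?] /setD1P[_ ?] /setD1P[_ ?]; apply: RB.
  - by rewrite (cardsD1 x A) xA in nA.
  - by rewrite (cardsD1 y B) yB in nB.
  exists k.+1, (x :: a), (y :: b).
  split; rewrite /= ?sa ?sb //; first split.
  - by rewrite ua andbT; apply/negP=> /aA; rewrite !inE eqxx.
  - by rewrite ub andbT; apply/negP=> /bB; rewrite !inE eqxx.
  - by move=> z; rewrite inE => /predU1P[->//|/aA/setD1P[]].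
  - by move=> z; rewrite inE => /predU1P[->//|/bB/setD1P[]].
  (* In the mixed cases, a relation between a member of the new pair and an older element would, by
     the matching hypotheses, identify that element with one that was deleted. *)
  move=> x0 [|i] [|j] //= i_lt j_lt; last exact: abE.
    have /bB/setD1P[/eqP neq mem] : nth x0 b j \in b by rewrite mem_nth ?sb.
    by apply/negP=> /(RA _ _ _ xA yB mem xy)/esym.
  have /aA/setD1P[/eqP neq mem] : nth x0 a i \in a by rewrite mem_nth ?sa.
  by apply/negP=> /(RB _ _ _ xA mem yB xy)/esym.
exists 0, (take n.+1 (enum A)), (take n.+1 (enum B)).
have sA := @mem_take n.+1 _ (enum A); have sB := @mem_take n.+1 _ (enum B).
split=> //; rewrite ?size_takel -?cardE //.
  by split; rewrite ?take_uniq ?enum_uniq // => z; [move/sA|move/sB]; rewrite mem_enum.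
move=> x0 i j i_lt j_lt; rewrite ltn0 andbF.
have := noR (nth x0 (take n.+1 (enum A)) i, nth x0 (take n.+1 (enum B)) j) => /=.
have -> : nth x0 (take n.+1 (enum A)) i \in A.
  by rewrite -mem_enum sA ?mem_nth ?size_takel -?cardE.
have -> // : nth x0 (take n.+1 (enum B)) j \in B.
by rewrite -mem_enum sB ?mem_nth ?size_takel -?cardE.
Qed.

(** * Sparse colourings from the absence of forbidden subgraphs *)

Section ForbiddenSubgraphs.
Variable G : sgraph.

Definition universal (x : G) : bool := [forall y, (y != x) ==> sedge x y].

Lemma universal_sedge x y : universal x -> y != x -> sedge x y.
Proof. by move=> /forallP/(_ y)/implyP. Qed.

Lemma not_universalP x :
  ~~ universal x -> exists2 y, x != y & ~~ sedge x y.
Proof.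
by rewrite negb_forall => /existsP[y]; rewrite negb_imply eq_sym => /andP[? ?]; exists y.
Qed.

Lemma contains_K5_minus_e (x z y1 y2 y3 : G) : x != z -> ~~ sedge x z ->
  all (fun y => sedge x y && sedge z y) [:: y1; y2; y3] ->
  sedge y1 y2 -> sedge y1 y3 -> sedge y2 y3 ->
  contains_induced G K5_minus_e.
Proof.
move=> xz xzN /and4P[/andP[x1 z1] /andP[x2 z2] /andP[x3 z3] _] y12 y13 y23.
have u : uniq [:: x; z; y1; y2; y3] by rewrite /= !inE !negb_or xz !sedge_neq.
apply/contains_inducedP; exists (fun i : 'I_5 => nth x [:: x; z; y1; y2; y3] i).
split=> [i j /eqP|]; first by rewrite nth_uniq // => /eqP/val_inj.
move=> [[|[|[|[|[|//]]]]] ?] [[|[|[|[|[|//]]]]] ?];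
  by rewrite /= /K5e_rel /= ?sedge_irrefl ?(negPf xzN) // sedge_sym ?(negPf xzN).
Qed.

Lemma contains_two_triangles k (u : G) (a b : seq G) :
  universal u -> u \notin a -> u \notin b ->
  uniq a -> uniq b -> size a = 3 -> size b = 3 ->
  {in a &, forall x y, x != y -> sedge x y} ->
  {in b &, forall x y, x != y -> sedge x y} ->
  {in a & b, forall x y, x != y} ->
  (forall i j, i < 3 -> j < 3 ->
     sedge (nth u a i) (nth u b j) = (i == j) && (i < k)) ->
  contains_induced G (two_triangles k).
Proof.
move=> uu ua ub aU bU sa sb aC bC ab abE.
pose f (v : two_triangles k) :=
  if v is Some (s, i) then nth u (if s then b else a) i else u.
have mema (i : 'I_3) : nth u a i \in a by rewrite mem_nth ?sa.
have memb (i : 'I_3) : nth u b i \in b by rewrite mem_nth ?sb.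
have fu s (i : 'I_3) : nth u (if s then b else a) i != u.
  by case: s; [apply: contraNneq ub => <-|apply: contraNneq ua => <-].
have nea (i j : 'I_3) : (nth u a i == nth u a j) = (i == j) by rewrite nth_uniq ?sa.
have neb (i j : 'I_3) : (nth u b i == nth u b j) = (i == j) by rewrite nth_uniq ?sb.
apply/contains_inducedP; exists f; split.
  move=> [[s i]|] [[t j]|] //= /eqP.
  - case: s t => [] [] /=.
    + by rewrite neb => /eqP->.
    + by rewrite eq_sym (negPf (ab _ _ _ _)).
    + by rewrite (negPf (ab _ _ _ _)).
    + by rewrite nea => /eqP->.
  - by rewrite (negPf (fu s i)).
  - by rewrite eq_sym (negPf (fu t j)).
move=> [[s i]|] [[t j]|] /=; last exact: sedge_irrefl.
- case: s t => [] [] /=.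
  + by have [->|ij] := eqVneq i j; rewrite ?sedge_irrefl ?bC ?neb.
  + by rewrite sedge_sym abE // eq_sym val_eqE; case: eqP => // ->.
  + by rewrite abE.
  + by have [->|ij] := eqVneq i j; rewrite ?sedge_irrefl ?aC ?nea.
- by rewrite sedge_sym universal_sedge.
- by rewrite universal_sedge.
Qed.

Hypothesis K5e_free : ~ contains_induced G K5_minus_e.

(** A non-neighbour [z] of [x] lies in the other clique, hence is adjacent to every cross neighbour
    of [x]. Three of these together with [x] and [z] would induce [K5_minus_e]. *)
Lemma not_universal_cross_nbrs c x :
  clique_coloring c -> ~~ universal x -> #|cross_nbrs c x| <= 2.
Proof.
move=> cc /not_universalP[z xz xzN]; rewrite leqNgt; apply/negP.
case/card_gt2P=> y1 [y2 [y3 [[]]]]; rewrite !in_cross_nbrs.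
move=> /andP[x1 c1] /andP[x2 c2] /andP[x3 c3] [n12 n23 n31]; apply: K5e_free.
have cz : c x != c z by apply: contra xzN => /eqP/(cc _ _ xz).
have adj y y' : y != y' -> c x != c y -> c x != c y' -> sedge y y'.
  by move=> yy' cy cy'; apply: cc => //; case: (c x) (c y) (c y') cy cy' => [] [] [].
have zy y : sedge x y -> z != y by apply: contraTneq => <-.
apply: (contains_K5_minus_e xz xzN (y1 := y1) (y2 := y2) (y3 := y3));
  rewrite /= ?x1 ?x2 ?x3 ?adj ?zy //.
by rewrite eq_sym.
Qed.

(* [universal u] lets [u] count as a third neighbour of [x] across. *)
Lemma cross_nbrs_matching c u x y z : clique_coloring c -> universal u ->
  ~~ universal x -> ~~ universal y -> ~~ universal z -> c y = c z -> c x != c y ->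
  sedge x y -> sedge x z -> y = z.
Proof.
move=> cc uu xN yN zN cyz cxy xy xz; apply/eqP; apply: contraT => yz.
have [w xw xwN] := not_universalP xN.
have nu v : ~~ universal v -> v != u by apply: contraNneq => ->.
have uE v : v != u -> sedge v u by move=> vu; rewrite sedge_sym universal_sedge.
have wu : w != u by apply: contraNneq xwN => ->; apply/uE/nu.
(* Since [w] is not adjacent to [x], it lies in the clique of [y] and [z] and is adjacent to both;
   [x] and [w] become the ends of the missing edge. *)
have cw : c w = c y.
  have: c x != c w by apply: contra xwN => /eqP/(cc _ _ xw).
  by case: (c x) (c y) (c w) cxy => [] [] [].
have wE v : sedge x v -> c v = c y -> sedge w v.
  by move=> xv cv; apply: cc; rewrite ?cw //; apply: contraNneq xwN => ->.
case: K5e_free; apply: (contains_K5_minus_e xw xwN (y1 := y) (y2 := z) (y3 := u)).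
- by rewrite /= xy xz (uE x) ?nu // (uE w) // !wE.
- exact: cc.
- exact/uE/nu.
- exact/uE/nu.
Qed.

Hypothesis triangles_free :
  forall k, k <= 3 -> ~ contains_induced G (two_triangles k).

Lemma free_sparse_coloring c :
  @clique_coloring G c -> exists c', @sparse_coloring G c'.
Proof.
move=> cc; pose N s := [set x | ~~ universal x & c x == s].
have small s : #|N s| <= 2 -> exists c', @sparse_coloring G c'.
  (* All universal vertices move to the class [~~ s]; the other vertices keep their colour. *)
  move=> Ns; pose c' x := if x \in N s then s else ~~ s.
  have c'E x : ~~ universal x -> c' x = c x.
    by move=> xN; rewrite /c' inE xN /=; case: (c x) s {Ns c'} => [] [].
  have cc' : clique_coloring c'.
    move=> x y xy; case: (boolP (universal x)) => [ux|xN].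
      by rewrite universal_sedge // eq_sym.
    case: (boolP (universal y)) => [uy|yN]; first by rewrite sedge_sym universal_sedge.
    by rewrite !c'E //; apply: cc.
  exists c'; split=> // x; case: (boolP (universal x)); last exact: not_universal_cross_nbrs.
  (* A universal vertex has colour [~~ s], so its cross neighbours all lie in [N s]. *)
  move=> ux; apply: leq_trans Ns; apply/subset_leq_card/subsetP=> y.
  rewrite in_cross_nbrs => /andP[_]; rewrite /c' [x \in _]inE ux /=.
  by case: (y \in N s); rewrite ?eqxx.
have [/small//|Nf] := leqP #|N false| 2; have [/small//|Nt] := leqP #|N true| 2.
have [u uu|noU] := pickP universal; last first.
  by exists c; split=> // x; apply: not_universal_cross_nbrs; rewrite ?noU.
have NE s x : x \in N s -> ~~ universal x /\ c x = s.
  by rewrite inE => /andP[? /eqP].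
(* Both sides now have at least three non-universal vertices and [u] is universal, so the edges
   between the sides form a matching. *)
have [||k [a [b [k3 sa sb [aU bU aN bN] abE]]]] :=
    @matching_enumeration G (@sedge G) 3 (N false) (N true) _ _ Nf Nt.
- move=> x y z /NE[xN cx] /NE[yN cy] /NE[zN cz].
  by apply: (cross_nbrs_matching cc uu); rewrite ?cx ?cy ?cz.
- move=> x y z /NE[xN cx] /NE[yN cy] /NE[zN cz].
  rewrite (sedge_sym x) (sedge_sym y).
  by apply: (cross_nbrs_matching cc uu); rewrite ?cx ?cy ?cz.
have uN s v : {subset v <= N s} -> u \notin v.
  by move=> vN; apply/negP=> /vN/NE[]; rewrite uu.
have clq s v : {subset v <= N s} -> {in v &, forall x y, x != y -> sedge x y}.
  by move=> vN x y /vN/NE[_ cx] /vN/NE[_ cy] xy; apply: cc; rewrite ?cx ?cy.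
case: (triangles_free k3).
apply: (contains_two_triangles (u := u) (a := a) (b := b)) => //;
  [exact: uN aN|exact: uN bN|exact: clq aN|exact: clq bN| |exact: abE].
by move=> x y /aN/NE[_ cx] /bN/NE[_ cy]; apply: contra_eqN cx => /eqP->; rewrite cy.
Qed.

End ForbiddenSubgraphs.

Theorem theorem9 (G : sgraph) :
  proper_2_color_line G <->
  co_bipartite G /\
  ~ contains_induced G K5_minus_e /\
  ~ contains_induced G F1 /\
  ~ contains_induced G F2 /\
  ~ contains_induced G F3 /\
  ~ contains_induced G F4.
Proof.
split=> [/proper_2_color_lineP[c sc]|[/co_bipartiteP[c cc] [K [T1 [T2 [T3 T4]]]]]].
  have free F : (forall c', ~ @sparse_coloring F c') -> ~ contains_induced G F.
    by move=> FN /(sparse_coloring_induced sc)[c' /FN].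
  split; first by apply/co_bipartiteP; exists c; case: sc.
  by do ![split]; apply: free => c';
    first [exact: K5_minus_e_not_sparse | exact: two_triangles_not_sparse].
apply/proper_2_color_lineP; apply: (free_sparse_coloring K _ cc).
(* The values 0 to 3 of [k] are exactly the graphs [F1] to [F4]. *)
by case=> [|[|[|[|//]]]].
Qed.
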